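(* Let a group $G$ act on a topological space $Y$ and by isometries on a metric space $Z$, and suppose there is a compact set $K\subset Y$ with $G\cdot K=Y$. If $a,b:Y\to Z$ are continuous and $G$-equivariant, then $\sup_{y\in Y}d_Z(a(y),b(y))<\infty$.
   Context: $d_Z$ denotes the metric of $Z$; $G\cdot K=\{\gamma y:\gamma\in G,\ y\in K\}$. *)

(* Defs.v *)
From mathcomp Require Import all_boot all_order all_algebra.
From mathcomp Require Import all_classical all_reals all_analysis.

Set Implicit Arguments.
Unset Strict Implicit.
Unset Printing Implicit Defensive.

Local Open Scope classical_set_scope.
Local Open Scope ring_scope.

(* MathComp's [action] and [{action: aT &-> T}] require a finite group and are
   right actions, so left actions of an arbitrary group are defined here. *)
Definition left_action (G : groupType) (T : Type) (act : G -> T -> T) : Prop :=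
  (forall x, act 1%g x = x) /\
  (forall g h x, act (g * h)%g x = act g (act h x)).

(* Continuity of every [act g] makes every [act g] a homeomorphism, the inverse
   being [act g^-1]. *)
Definition topological_action (G : groupType) (Y : topologicalType)
    (act : G -> Y -> Y) : Prop :=
  left_action act /\ (forall g, continuous (act g)).

Definition isometric_action (R : realType) (G : groupType) (Z : metricType R)
    (act : G -> Z -> Z) : Prop :=
  left_action act /\
  (forall g z w, mdist (act g z) (act g w) = mdist z w).

Definition translates (G : groupType) (T : Type) (act : G -> T -> T)
    (K : set T) : set T :=
  [set act g y | g in [set: G] & y in K].

Definition equivariant (G : groupType) (S T : Type) (actS : G -> S -> S)
    (actT : G -> T -> T) (f : S -> T) : Prop :=
  forall g s, f (actS g s) = actT g (f s).

(* Main.v *)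
(** By equivariance and isometry, [y |-> mdist (a y) (b y)] is [G]-invariant, so
    its bound on the compact set [K] is a bound on the whole of [Y]. *)
Require Import Defs.
From mathcomp Require Import all_boot all_order all_algebra.
From mathcomp Require Import all_classical all_reals all_analysis.

Import Order.TTheory GRing.Theory Num.Theory.

Local Open Scope classical_set_scope.
Local Open Scope ring_scope.

(** The distance between [a y] and [b y] is constant on orbits, and every orbit meets [K], so
    [mdist_bounded_on_compact] is all that is needed. That lemma turns local bounds, given by
    continuity, into one bound by compactness in its near-covering form. *)

Lemma mdist_bounded_on_compact (R : realType) (Y : topologicalType)
    (Z : metricType R) (a b : Y -> Z) (K : set Y) :
  continuous a -> continuous b -> compact K ->
  exists M : R, forall y, K y -> mdist (a y) (b y) <= M.
Proof.
move=> ca cb /compact_near_coveringP cK.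
pose P (M : R) (y : Y) := mdist (a y) (b y) <= M.
(* With the filter at [+oo], near-covering only asks that each [x] in [K] have [P M y] for all [y]
   near [x] and all large [M]. *)
suff: \forall M \near +oo, K `<=` P M.
  by move/filter_ex => [M KM]; exists M => y /KM.
apply: (cK R (pinfty_nbhs R) P) => x _.
have na : \forall t \near x, mdist (a x) (a t) <= 1.
  exact: metricType_numDomainType.cvgr_dist_le (ca x) _ ltr01.
have nb : \forall t \near x, mdist (b x) (b t) <= 1.
  exact: metricType_numDomainType.cvgr_dist_le (cb x) _ ltr01.
near=> y M; rewrite /P /=.
apply: (le_trans (metric_triangle _ (a x) _)).
rewrite metric_sym.
apply: (le_trans (lerD (lexx _) (metric_triangle _ (b x) _))).
(* The detour through [a x] and [b x] costs at most 1 at each end, which fixes how large [M] must be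
   near [x]. *)
apply: (@le_trans _ _ (1 + (mdist (a x) (b x) + 1))).
  by apply: lerD; [near: y|rewrite lerD2l; near: y].
by near: M; apply: nbhs_pinfty_ge; rewrite num_real.
Unshelve. all: by end_near. Qed.

Theorem lemma2p2 (R : realType) (G : groupType) (Y : topologicalType)
    (Z : metricType R) (actY : G -> Y -> Y) (actZ : G -> Z -> Z)
    (hY : topological_action actY) (hZ : isometric_action actZ)
    (hK : exists K : set Y, compact K /\ translates actY K = [set: Y])
    (a b : Y -> Z) (ca : continuous a) (cb : continuous b)
    (ea : equivariant actY actZ a) (eb : equivariant actY actZ b) :
  (ereal_sup (range (fun y : Y => (mdist (a y) (b y))%:E)) < +oo)%E.
Proof.
have [K [cK KY]] := hK; have [_ isoZ] := hZ.
have [M KM] := mdist_bounded_on_compact _ _ _ _ _ _ ca cb cK.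
(* A real upper bound suffices, even for empty [Y], where the supremum is [-oo]. *)
apply: (@le_lt_trans _ _ M%:E); last exact: ltry.
apply: ge_ereal_sup => _ [y _ <-]; rewrite lee_fin.
have : [set: Y] y by [].
(* The point becomes [actY g x] with [x] in [K]; equivariance moves [g] outside both maps and the
   isometry cancels it. *)
rewrite -KY => -[g _ [x Kx <-]].
by rewrite ea eb isoZ; exact: KM.
Qed.
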